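(* Let $n\ge1$ be an integer, $p>1$, $\lambda\in\mathbb C\setminus\{0\}$ and $m\in\mathbb R$. Let $\alpha\in\mathbb C$ satisfy $\mathrm{Re}(\alpha\lambda)>0$, let $k<\min(n/2,1/(p-1))$, and let $f\in L^2(\mathbb R^n)$ satisfy $$-\mathrm{Im}(\alpha f(x))\ge\begin{cases}|x|^{-k},&\text{if }|x|\le1,\\ 0,&\text{if }|x|>1.\end{cases}$$ For $\mu>0$ put $u_0=\mu f$. Then there exist $\mu_0>0$ and a constant $C>0$ independent of $\mu$ such that for every $\mu>\mu_0$ there exists $R_1>0$ satisfying $$M_{R_1}(0)>\widetilde C_{n,p,\alpha}\,\langle R_1m\rangle^{(n+2)/(p-1)}\,R_1^{\,n-1/(p-1)}$$ and $$\widetilde T_{n,p,m,\lambda,\alpha,R_1}\le C\mu^{-\frac{1}{1/(p-1)-k}}.$$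
   Context: Notation: $\langle x\rangle=(1+|x|^2)^{1/2}$ for $x\in\mathbb R^n$ or $x\in\mathbb R$; $p'=p/(p-1)$. For $R>0$ and initial data $u_0$, $$M_R(0)=-\mathrm{Im}\Bigl(\alpha\int_{\mathbb R^n}u_0(x)\langle x/R\rangle^{-n-1}\,dx\Bigr).$$ The constants are: $\widetilde C_{n,p,\alpha}>0$ with $$\widetilde C_{n,p,\alpha}^{\,p}=2^{1+p'/p}\,p^{-p'/p}\,p'^{-1}\,\mathrm{Re}(\alpha\lambda)^{-p'}\,|\alpha|^{p+p'}\,\widetilde A_n^{\,p'}\Bigl(\int_{\mathbb R^n}\langle x\rangle^{-n-1}\,dx\Bigr)^p,$$ $$D_{n,p,\lambda,\alpha}=2^{-1}\,\mathrm{Re}(\alpha\lambda)\,|\alpha|^{-p}\Bigl(\int_{\mathbb R^n}\langle x\rangle^{-n-1}\,dx\Bigr)^{-p+1},$$ $$\widetilde T_{n,p,m,\lambda,\alpha,R}=(p-1)^{-1}D_{n,p,\lambda,\alpha}^{-1}\,R^{n(p-1)}\Bigl(M_R(0)-\langle Rm\rangle^{(n+2)/(p-1)}\,\widetilde C_{n,p,\alpha}\,R^{\,n-1/(p-1)}\Bigr)^{-p+1}.$$ Here $\widetilde A_n=A_{n,n+1}+2^{(n+1)/2}\|\langle\cdot\rangle^{n+1}K\|_{L^1(\mathbb R^n)}$, where $K$ is the integral kernel of the Bessel potential $(1-\Delta)^{-1/2}$ (Fourier multiplier with symbol $(1+|\xi|^2)^{-1/2}$), i.e. $(1-\Delta)^{-1/2}\phi=K*\phi$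 for Schwartz $\phi$, and $A_{n,n+1}$ is a positive constant, depending only on $n$, such that $|((-\Delta)^{1/2}\langle\cdot\rangle^{-n-1})(x)|\le A_{n,n+1}\langle x\rangle^{-n-1}$ for all $x\in\mathbb R^n$ (such a constant is known to exist; $(-\Delta)^{1/2}$ is the Fourier multiplier with symbol $|\xi|$). ($\widetilde T_{n,p,m,\lambda,\alpha,R}$ is the upper bound for the existence time of solutions of $i\partial_tu+(m^2-\Delta)^{1/2}u=\lambda|u|^p$, $u(0)=u_0$.) *)

(* Defs.v *)
From HB Require Import structures.
From mathcomp Require Import all_boot all_order all_algebra.
From mathcomp Require Import complex.
From mathcomp Require Import all_classical all_reals all_analysis.

Set Implicit Arguments.
Unset Strict Implicit.
Unset Printing Implicit Defensive.

Import Order.TTheory GRing.Theory Num.Theory.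
Import numFieldNormedType.Exports.
Import ComplexField.Normc.

Local Open Scope classical_set_scope.
Local Open Scope ring_scope.
Local Open Scope complex_scope.

(* The sigma-algebra generated by the coordinates, i.e. the Borel
   sigma-algebra of R^n. *)
Section rV_measurable.
Variables (R : realType) (n : nat).

Definition coor (i : 'I_n) (x : 'rV[R]_n) : R := x 0 i.

Let rV_set0 : g_sigma_preimage coor set0.
Proof. exact: sigma_algebra0. Qed.

Let rV_setC A : g_sigma_preimage coor A -> g_sigma_preimage coor (~` A).
Proof. exact: sigma_algebraC. Qed.

Let rV_bigcup (F : (set 'rV[R]_n)^nat) :
  (forall i, g_sigma_preimage coor (F i)) ->
  g_sigma_preimage coor (\bigcup_i (F i)).
Proof. exact: sigma_algebra_bigcup. Qed.

HB.instance Definition _ := @isMeasurable.Build default_measure_display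
  'rV[R]_n (g_sigma_preimage coor) rV_set0 rV_setC rV_bigcup.

Lemma measurable_coor (i : 'I_n) : measurable_fun [set: 'rV[R]_n] (coor i).
Proof.
move=> _ Y mY; rewrite setTI; apply: sub_sigma_algebra => /=.
rewrite -bigcup_seq/=; exists i => /=; first by rewrite mem_index_enum.
by exists Y => //; rewrite setTI.
Qed.

Lemma measurable_fun_coorP d (T : measurableType d) (f : T -> 'rV[R]_n) :
  (forall i, measurable_fun [set: T] (fun t => f t 0 i)) ->
  measurable_fun [set: T] f.
Proof.
move=> mf; suff: g_sigma_preimage (fun i => coor i \o f) `<=` measurable.
  rewrite g_sigma_preimage_comp => sub _ A mA.
  by apply: sub; exists A.
apply: smallest_sub; first exact: sigma_algebra_measurable.
rewrite -bigcup_seq => A [i _] [B mB <-].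
exact: mf.
Qed.

End rV_measurable.

Section lebesgue_measure_rV.
Variable R : realType.

Definition cons_rV n (p : R * 'rV[R]_n) : 'rV[R]_n.+1 :=
  row_mx (p.1%:M : 'rV_1) p.2.

Lemma measurable_cons_rV n : measurable_fun [set: R * 'rV[R]_n] (@cons_rV n).
Proof.
apply: measurable_fun_coorP => i.
case: (split_ordP (i : 'I_(1 + n))) => j ->.
  rewrite (_ : (fun p => _) = fst) ?funeqE; first exact: measurable_fst.
  by move=> p; rewrite [LHS](@row_mxEl _ 1 1 n) ord1 mxE eqxx mulr1n.
rewrite (_ : (fun p => _) = coor j \o snd) ?funeqE; last first.
  by move=> p; rewrite [LHS](@row_mxEr _ 1 1 n).
exact: measurableT_comp (measurable_coor j) measurable_snd.
Qed.

HB.instance Definition _ n :=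
  isMeasurableFun.Build _ _ _ _ (@cons_rV n) (@measurable_cons_rV n).

Section leb_cons.
Variables (n : nat) (mu : {measure set 'rV[R]_n -> \bar R}).

Definition leb_cons :=
  pushforward (lebesgue_measure \x^ mu)%E (@cons_rV n).

Let leb_cons0 : leb_cons set0 = 0%E.
Proof. by apply: measure0; exact: measurable_cons_rV. Qed.

Let leb_cons_ge0 A : (0 <= leb_cons A)%E.
Proof. by apply: measure_ge0; exact: measurable_cons_rV. Qed.

Let leb_cons_sigma_additive : semi_sigma_additive leb_cons.
Proof. by apply: measure_semi_sigma_additive; exact: measurable_cons_rV. Qed.

HB.instance Definition _ := isMeasure.Build _ _ _ leb_cons
  leb_cons0 leb_cons_ge0 leb_cons_sigma_additive.

End leb_cons.

(* Lebesgue measure on R^n, as the n-fold product of the one on R. *)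
Fixpoint leb n : {measure set 'rV[R]_n -> \bar R} :=
  match n with
  | 0 => dirac (0 : 'rV[R]_0)
  | n'.+1 => leb_cons (leb n')
  end.

Lemma leb_box n (I : 'I_n -> set R) : (forall i, measurable (I i)) ->
  leb n [set x | forall i, I i (x 0 i)] =
  (\prod_(i < n) lebesgue_measure (I i))%E.
Proof.
elim: n I => [|n ih] I mI.
  by rewrite big_ord0 /= diracE mem_set//= => -[].
pose J i := I (lift ord0 i).
have mJ : measurable [set x : 'rV[R]_n | forall i, J i (x 0 i)].
  rewrite (_ : [set _ | _] = \bigcap_i (coor i @^-1` J i)); last first.
    by apply/seteqP; split => x /= + i => /(_ i); [move=> + _|exact].
  apply: fin_bigcap_measurable => // i _.
  rewrite -[X in measurable X]setTI.
  exact: (measurable_coor i) measurableT _ (mI _).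
rewrite big_ord_recl -ih => [|i]; last exact: mI.
rewrite -(product_measure2E lebesgue_measure (leb n) (mI ord0) mJ).
rewrite /= /leb_cons /pushforward; congr product_measure2.
have hd p : @cons_rV n p 0 ord0 = p.1.
  rewrite (_ : ord0 = lshift n (ord0 : 'I_1)); last exact: val_inj.
  by rewrite [LHS](@row_mxEl _ 1 1 n) mxE eqxx.
have tl p i : @cons_rV n p 0 (lift ord0 i) = p.2 0 i.
  rewrite (_ : lift ord0 i = rshift 1 i); last exact: val_inj.
  by rewrite [LHS](@row_mxEr _ 1 1 n).
apply/seteqP; split => p /=.
  by move=> Ip; split => [|i]; [have := Ip ord0; rewrite hd
                               |have := Ip (lift ord0 i); rewrite tl].
move=> [I0 Ii] i; case: (unliftP ord0 i) => [k ->|->].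
  by rewrite tl; exact: Ii.
by rewrite hd.
Qed.

End lebesgue_measure_rV.

Section notions.
Variables (R : realType) (n : nat).
Implicit Types (x y xi : 'rV[R]_n) (phi K u f : 'rV[R]_n -> R[i]).

Definition dot x y : R := \sum_(i < n) x 0 i * y 0 i.

(* The Euclidean norm; the library norm `|x| on 'rV[R]_n is the sup norm. *)
Definition enorm x : R := Num.sqrt (dot x x).

(* The Japanese bracket <t>, and <x> for vectors. *)
Definition jap (t : R) : R := Num.sqrt (1 + t ^+ 2).

Definition japv x : R := jap (enorm x).

Definition measurableC f : Prop :=
  measurable_fun [set: 'rV[R]_n] (fun x => complex.Re (f x)) /\
  measurable_fun [set: 'rV[R]_n] (fun x => complex.Im (f x)).

Definition integrableC f : Prop :=
  (leb R n).-integrable [set: 'rV[R]_n] (fun x => (complex.Re (f x))%:E) /\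
  (leb R n).-integrable [set: 'rV[R]_n] (fun x => (complex.Im (f x))%:E).

Definition integralC f : R[i] :=
  Complex (\int[leb R n]_x complex.Re (f x)) (\int[leb R n]_x complex.Im (f x)).

Definition L2 f : Prop :=
  measurableC f /\ finite_norm (leb R n) 2%:E (fun x => normc (f x)).

Definition cis (t : R) : R[i] := Complex (cos t) (sin t).

Definition fourier phi xi : R[i] :=
  integralC (fun x => cis (- dot x xi) * phi x).

(* With the normalisation of [fourier] above, the factor (2 pi)^-n makes the
   multiplier of symbol 1 the identity. *)
Definition fourier_multiplier (sigma : 'rV[R]_n -> R) phi x : R[i] :=
  ((2 * pi) ^- n)%:C *
  integralC (fun xi => cis (dot x xi) * (sigma xi)%:C * fourier phi xi).

(* (-Delta)^(1/2) *)
Definition half_laplacian phi := fourier_multiplier enorm phi.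

(* (1 - Delta)^(-1/2) *)
Definition bessel_potential phi :=
  fourier_multiplier (fun xi => (japv xi)^-1) phi.

Definition iter_partial (s : seq 'I_n) (g : 'rV[R]_n -> R) : 'rV[R]_n -> R :=
  foldr (fun i h => fun x => 'D_(delta_mx 0 i : 'rV[R]_n) h x) g s.

Definition schwartzR (g : 'rV[R]_n -> R) : Prop :=
  forall s : seq 'I_n,
    (forall x, differentiable (iter_partial s g) x) /\
    (forall k : nat, exists M : R,
       forall x, japv x ^+ k * `|iter_partial s g x| <= M).

Definition schwartz phi : Prop :=
  schwartzR (fun x => complex.Re (phi x)) /\ schwartzR (fun x => complex.Im (phi x)).

(* Determines K almost everywhere. *)
Definition is_bessel_kernel K : Prop :=
  measurableC K /\
  forall phi, schwartz phi -> forall x,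
    integrableC (fun y => K (x - y) * phi y) /\
    integralC (fun y => K (x - y) * phi y) = bessel_potential phi x.

Definition is_half_laplacian_bound (A : R) : Prop :=
  0 < A /\
  forall x, normc (half_laplacian (fun y => (japv y ^- n.+1)%:C) x)
            <= A * japv x ^- n.+1.

(* Real-valued; the Bessel kernel decays exponentially and is integrable at the
   origin, so [fine] is not applied to +oo in [Atilde]. *)
Definition L1norm f : R :=
  fine ('N[leb R n]_1[EFin \o (fun x => normc (f x))]).

Definition Atilde (A : R) K : R :=
  A + 2 `^ (n.+1%:R / 2)
      * L1norm (fun x => (japv x ^+ n.+1)%:C * K x).

Definition int_japv : R := \int[leb R n]_x (japv x ^- n.+1).

Definition conj_exp (p : R) : R := p / (p - 1).

(* The positive p-th root of the expression defining [Ctilde ^ p]. *)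
Definition Ctilde (p : R) (lambda alpha : R[i]) (A : R) K : R :=
  let p' := conj_exp p in
  (2 `^ (1 + p' / p) * p `^ (- (p' / p)) * p'^-1
   * complex.Re (alpha * lambda) `^ (- p') * normc alpha `^ (p + p')
   * Atilde A K `^ p' * int_japv `^ p) `^ p^-1.

Definition Dconst (p : R) (lambda alpha : R[i]) : R :=
  2^-1 * complex.Re (alpha * lambda) * normc alpha `^ (- p) * int_japv `^ (- p + 1).

(* [Mfun alpha u0 r] is M_r(0). *)
Definition Mfun (alpha : R[i]) u (r : R) : R :=
  - complex.Im (alpha * integralC (
      fun x => u x * (japv (r^-1 *: x) ^- n.+1)%:C)).

Definition Ttilde (p m : R) (lambda alpha : R[i]) (A : R) K u (r : R) : R :=
  (p - 1)^-1 * (Dconst p lambda alpha)^-1 * r `^ (n%:R * (p - 1))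
  * (Mfun alpha u r
     - jap (r * m) `^ (n.+2%:R / (p - 1)) * Ctilde p lambda alpha A K
       * r `^ (n%:R - 1 / (p - 1))) `^ (- p + 1).

End notions.

(* Main.v *)
Require Import Defs.
From mathcomp Require Import all_boot all_order all_algebra.
From mathcomp Require Import complex.
From mathcomp Require Import measurable_realfun.
From mathcomp Require Import ring lra.
From mathcomp Require Import all_classical all_reals all_analysis.

(** Put [g = - Im (alpha f)], which is nonnegative almost everywhere and at
    least [|x|^-k] on the unit ball, and let [w_r(x) = <x/r>^(-n-1)].  Then
    [M_r(0) = mu * \int g w_r]: the real-linear map [- Im (alpha .)] passes
    through the integral because [f w_r] is integrable, which follows from
    [|f| w_r <= |f|^2 + w_r] and the integrability of [w_r]
    ([integrable_weight], [MfunE]).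

    For [r <= 1] the part of this integral over a box of side comparable to [r],
    contained in the ball of radius [r] and at distance comparable to [r] from
    the origin, already gives [M_r(0) >= mu c r^(n-k)] with [c] independent of
    [mu] and [r] ([Mfun_lower]).  As [<rm> <= <m>] for [r <= 1], the threshold
    for blow-up is at most [B r^(n-1/(p-1))] with [B] independent of [r].  Take
    [b = B + 1] and let [r] solve [mu c r^q = 2 b], where [q = 1/(p-1) - k > 0];
    this [r] is at most [1] as soon as [mu > mu0 = 2 b / c].  Then [M_r(0)] is
    at least [2 b r^(n-1/(p-1))], so it exceeds the threshold by at least
    [b r^(n-1/(p-1))].  In the bound for the existence time the powers of [r]
    then combine to [r] itself ([powR_lifespan]), and [r] is a constant times
    [mu^(-1/q)]. *)

Import Order.TTheory GRing.Theory Num.Theory.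
Import numFieldNormedType.Exports.
Local Open Scope classical_set_scope.
Local Open Scope ring_scope.
Local Open Scope complex_scope.

(** * Euclidean norm, Japanese bracket and boxes in R^n *)

Section euclidean.
Context {R : realType} {n : nat}.
Implicit Types (x : 'rV[R]_n) (r t : R).

Lemma dot_ge0 x : 0 <= dot x x.
Proof. by apply: sumr_ge0 => i _; rewrite -expr2 sqr_ge0. Qed.

Lemma dotZ r x : dot (r *: x) (r *: x) = r ^+ 2 * dot x x.
Proof.
by rewrite /dot mulr_sumr; apply: eq_bigr => i _; rewrite !mxE; ring.
Qed.

Lemma sqr_coord_le_dot x i : x 0 i ^+ 2 <= dot x x.
Proof.
rewrite /dot (bigD1 i)//= -expr2 lerDl.
by apply: sumr_ge0 => j _; rewrite -expr2 sqr_ge0.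
Qed.

Lemma japvE x : japv x = Num.sqrt (1 + dot x x).
Proof. by rewrite /japv /jap sqr_sqrtr// dot_ge0. Qed.

Lemma japv_ge1 x : 1 <= japv x.
Proof. by rewrite japvE -[leLHS]sqrtr1 ler_wsqrtr// lerDl dot_ge0. Qed.

Lemma japv_gt0 x : 0 < japv x.
Proof. exact: lt_le_trans ltr01 (japv_ge1 x). Qed.

Lemma norm_coord_le_japv x i : `|x 0 i| <= japv x.
Proof.
rewrite japvE -sqrtr_sqr ler_wsqrtr// (le_trans (sqr_coord_le_dot x i))//.
by rewrite lerDr.
Qed.

Lemma measurable_japvXN (r : R) (m : nat) :
  measurable_fun [set: 'rV[R]_n] (fun x => japv (r *: x) ^- m).
Proof.
rewrite (_ : (fun x => _) =
    (fun t => t `^ (- (2^-1 * m%:R))) \o (fun x => 1 + r ^+ 2 * dot x x)); last first.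
  apply/funext => x /=; rewrite japvE dotZ powRN powRrM powR_mulrn ?powR_ge0// powR12_sqrt//.
  by rewrite addr_ge0// mulr_ge0// ?dot_ge0// sqr_ge0.
apply: measurableT_comp; first exact: measurable_powR.
apply: measurable_funD => //; apply: measurable_funM => //.
by apply: measurable_sum => i; apply: measurable_funM; exact: measurable_coor.
Qed.

Definition box (a b : R) : set 'rV[R]_n := [set x | forall i, x 0 i \in `[a, b]].

Lemma measurable_box a b : measurable (box a b).
Proof.
rewrite (_ : box a b = \bigcap_i (coor i @^-1` [set` `[a, b]])); last first.
  by apply/seteqP; split => x /= + i => /(_ i); [move=> + _|exact].
apply: fin_bigcap_measurable => // i _; rewrite -[X in measurable X]setTI.
by apply: (measurable_coor i) => //; exact: measurable_itv.
Qed.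

Lemma leb_boxE a b : a <= b -> leb R n (box a b) = ((b - a) ^+ n)%:E.
Proof.
move=> ab; rewrite (@leb_box _ _ (fun=> [set` `[a, b]]))//.
under eq_bigr do rewrite lebesgue_measure_itv/= lte_fin.
rewrite (_ : (if _ then _ else _) = (b - a)%:E).
  elim: n => [|m ih]; first by rewrite big_ord0.
  by rewrite big_ord_recr/= ih exprSr EFinM.
by case: ltgtP ab => // ->; rewrite subrr.
Qed.

End euclidean.

(** * Integrability of the weight *)

Section weight.
Context {R : realType} {n : nat}.
Implicit Types (x : 'rV[R]_n) (r t : R).

Definition weight r x : R := japv (r^-1 *: x) ^- n.+1.

Lemma weight_gt0 r x : 0 < weight r x.
Proof. by rewrite invr_gt0 exprn_gt0// japv_gt0. Qed.

Lemma weight_le1 r x : weight r x <= 1.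
Proof. by rewrite invf_le1 ?exprn_gt0 ?japv_gt0// exprn_ege1// japv_ge1. Qed.

Lemma weight_le_out r x i t : 0 < r -> 0 < t -> r * t < `|x 0 i| ->
  weight r x <= t ^- n.+1.
Proof.
move=> r0 t0 rtx; rewrite lef_pV2 ?posrE ?exprn_gt0 ?japv_gt0//.
rewrite lerXn2r ?nnegrE ?(ltW t0) ?(ltW (japv_gt0 _))//.
apply: le_trans (norm_coord_le_japv _ i); rewrite mxE normrM normfV (gtr0_norm r0).
by rewrite ler_pdivlMl// ltW.
Qed.

Lemma weight_ge_ball r x : 0 < r -> enorm x <= r -> (Num.sqrt 2) ^- n.+1 <= weight r x.
Proof.
move=> r0 xr; rewrite lef_pV2 ?posrE ?exprn_gt0 ?japv_gt0 ?sqrtr_gt0//.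
rewrite lerXn2r ?nnegrE ?sqrtr_ge0 ?(ltW (japv_gt0 _))//.
rewrite japvE ler_wsqrtr// dotZ -[2]/(1 + 1) lerD2l exprVn ler_pdivrMl ?exprn_gt0//.
rewrite mulr1 -[dot x x]sqr_sqrtr ?dot_ge0//.
by rewrite lerXn2r ?nnegrE ?sqrtr_ge0// ltW.
Qed.

(** On the dyadic shell of radius [r 2^j] the weight is at most a constant
    times [2^(-j(n+1))], while the cube of that size has volume
    [(2 r 2^j)^n].  The products decay like [2^-j], so the weight is dominated
    by a series of multiples of cube indicators with finite total integral. *)
Lemma integrable_weight r : 0 < r ->
  (leb R n).-integrable setT (EFin \o weight r).
Proof.
move=> r0.
have mw : measurable_fun setT (EFin \o weight r).
  by apply/measurable_EFinP; exact: measurable_japvXN.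
apply/integrableP; split => //.
pose B j : set 'rV[R]_n := box (- (r * 2 ^+ j)) (r * 2 ^+ j).
(* The factor [2 ^+ n.+1] pays for the shell [j.+1], where the weight is only
   known to be at most [2 ^- (j * n.+1)]. *)
pose c j : R := 2 ^+ n.+1 / 2 ^+ (j * n.+1).
have c0 j : 0 <= c j by rewrite divr_ge0// exprn_ge0.
pose F j x := ((c j)%:E * (\1_(B j) x)%:E)%E.
have F0 j x : (0 <= F j x)%E by rewrite mule_ge0// lee_fin.
have mF j : measurable_fun setT (F j).
  apply: emeasurable_funM => //; apply/measurable_EFinP.
  by apply: measurable_indic; exact: measurable_box.
have wF x : (`|(EFin \o weight r) x| <= \sum_(0 <= j <oo) F j x)%E.
  pose P j := [forall i, `|x 0 i| <= r * 2 ^+ j].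
  have exP : exists j, P j.
    have [j hj] : exists j : nat, forall i, `|x 0 i| <= r * j%:R.
      exists (Num.bound (japv (r^-1 *: x))) => i.
      have := norm_coord_le_japv (r^-1 *: x) i.
      rewrite mxE normrM normfV (gtr0_norm r0) ler_pdivrMl// => /le_trans; apply.
      rewrite ler_pM2l// ltW//.
      exact: archi_boundP (ltW (japv_gt0 _)).
    exists j; apply/forallP => i; apply: (le_trans (hj i)).
    by rewrite ler_pM2l// -natrX ler_nat ltnW// ltn_expl.
  (* The smallest cube containing [x] is the one whose term dominates. *)
  have [j Pj minj] := ex_minnP exP.
  apply: (@le_trans _ _ (F j x)); last first.
    apply: le_trans (nneseries_lim_ge j.+1 (fun i _ _ => F0 i x)).
    by rewrite big_nat_recr//= leeDr// sume_ge0.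
  rewrite /F /= indicE mem_set; last first.
    by move=> i /=; rewrite in_itv/= -ler_norml; exact: (forallP Pj).
  rewrite mule1 lee_fin (gtr0_norm (weight_gt0 _ _)).
  case: j Pj minj => [|j] Pj minj.
    rewrite /c mul0n expr0 divr1 (le_trans (weight_le1 _ _))//.
    by rewrite exprn_ege1// ler1n.
  have : ~~ P j by apply/negP => /minj; rewrite ltnn.
  move=> /forallPn[i0].
  rewrite -ltNge => hi0.
  apply: (le_trans (weight_le_out _ _ _ _ r0 _ hi0)); first by rewrite exprn_gt0.
  by rewrite -exprM /c mulSn exprD invfM mulrA divff// mul1r.
apply: (@le_lt_trans _ _ (\int[leb R n]_x \sum_(0 <= j <oo) F j x)%E).
  apply: ge0_le_integral => //.
  - by apply: measurableT_comp.
  - by apply: ge0_emeasurable_sum.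
rewrite integral_nneseries//.
have -> : (\sum_(0 <= j <oo) \int[leb R n]_x F j x =
    \sum_(0 <= j <oo) ((2 ^+ n.+1 * (2 * r) ^+ n * 2) / (2 ^ (j + 1))%:R : R)%:E)%E.
  apply: eq_eseriesr => j _.
  rewrite ge0_integralZl//; last 2 first.
  - apply/measurable_EFinP; apply: measurable_indic; exact: measurable_box.
  - by rewrite lee_fin.
  rewrite integral_indic ?setIT//; last exact: measurable_box.
  rewrite leb_boxE; last by rewrite ge0_cp// mulr_ge0 ?exprn_ge0// ltW.
  rewrite -EFinM; congr EFin; rewrite /c natrX opprK.
  have e2 m : (2 : R) ^+ m != 0 by rewrite expf_neq0.
  have -> : r * 2 ^+ j + r * 2 ^+ j = 2 * r * 2 ^+ j by ring.
  rewrite mulnS !exprD [(_ * 2 ^+ j) ^+ n]exprMn exprM expr1.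
  by field; rewrite !e2/= expf_neq0.
have /cvg_lim := @cvg_geometric_eseries_half R (2 ^+ n.+1 * (2 * r) ^+ n * 2) 0.
by rewrite /eseries/= => ->//; rewrite ltry.
Qed.

End weight.

(** * The functional M_R(0) *)

(** The difference [h - g] equals its absolute value almost everywhere, so its
    integral is that of a nonnegative function. *)
Lemma ae_le_Rintegral d (T : measurableType d) (R : realType)
    (mu : {measure set T -> \bar R}) (g h : T -> R) :
  mu.-integrable setT (EFin \o g) -> mu.-integrable setT (EFin \o h) ->
  {ae mu, forall x, g x <= h x} ->
  \int[mu]_x g x <= \int[mu]_x h x.
Proof.
move=> ig ih gh; rewrite -subr_ge0 -RintegralB//.
have iD : mu.-integrable setT (EFin \o (h \- g)%R).
  by rewrite (_ : _ \o _ = (EFin \o h) \- (EFin \o g))%E//; exact: integrableB.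
rewrite (_ : \int[mu]_x _ = \int[mu]_x `|h x - g x|).
  by apply: Rintegral_ge0.
congr fine; apply: ae_eq_integral => //.
- exact: measurable_int iD.
- apply/measurable_EFinP; apply: measurableT_comp => //.
  by apply/measurable_EFinP; exact: measurable_int iD.
- by apply: filterS gh => x ghx _; rewrite ger0_norm// subr_ge0.
Qed.

Section data.
Context {R : realType} {n : nat}.
Implicit Types (f : 'rV[R]_n -> R[i]) (x : 'rV[R]_n) (r k mu : R) (alpha : R[i]).

Lemma integrable_sqr_normc f : L2 f -> (leb R n).-integrable setT
  (EFin \o (fun x => complex.Re (f x) ^+ 2 + complex.Im (f x) ^+ 2)).
Proof.
move=> [[mRe mIm]]; rewrite /finite_norm unlock => L2lty.
have {L2lty} := lty_poweRy _ L2lty; rewrite invr_eq0 pnatr_eq0 => /(_ isT) fin.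
 apply/integrableP; split.
  by apply/measurable_EFinP; apply: measurable_funD; exact: measurable_funX.
apply: le_lt_trans fin; rewrite le_eqVlt; apply/orP; left; apply/eqP.
apply: eq_integral => x _ /=; congr EFin.
case: (f x) => a b /=; have ab0 : 0 <= a ^+ 2 + b ^+ 2 by rewrite addr_ge0 ?sqr_ge0.
by rewrite powR_mulrn// ger0_norm// (ger0_norm (sqrtr_ge0 _)) sqr_sqrtr.
Qed.

(** Meant for [g = Re f] and [g = Im f]; stated through squares so that the
    domination [|g| w <= |f|^2 + w] avoids the modulus of [f]. *)
Lemma integrable_mul_weight f r (g : 'rV[R]_n -> R) : L2 f -> 0 < r ->
  measurable_fun setT g ->
  (forall x, g x ^+ 2 <= complex.Re (f x) ^+ 2 + complex.Im (f x) ^+ 2) ->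
  (leb R n).-integrable setT (EFin \o (fun x => g x * weight r x)).
Proof.
move=> /integrable_sqr_normc i2 r0 mg gf.
have iw := @integrable_weight R n r r0.
apply: (le_integrable _ _ _ (integrableD _ i2 iw)) => //.
  apply/measurable_EFinP; apply: measurable_funM => //.
  exact: measurable_japvXN.
move=> x _ /=; rewrite lee_fin.
have w0 := weight_gt0 r x; have w1 := weight_le1 r x; have := gf x.
set N := (_ + _) => gN; have N0 : 0 <= N by rewrite addr_ge0 ?sqr_ge0.
rewrite normrM (gtr0_norm w0) (ger0_norm (addr_ge0 N0 (ltW w0))).
have := normr_ge0 (g x); rewrite -real_normK ?num_real// in gN.
move: gN; set a := `|g x| => gN a0.
(* [a <= a^2 + 1] and [w <= 1] give [a w <= a^2 + w]. *)
nra.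
Qed.

(** Integrability is returned together with the formula, as the lower bound on
    [M_r(0)] compares this same integral with that of a box indicator. *)
Lemma MfunE alpha f mu r : L2 f -> 0 < r ->
  Mfun alpha (fun x => mu%:C * f x) r =
    mu * \int[leb R n]_x (- complex.Im (alpha * f x) * weight r x)
  /\ (leb R n).-integrable setT
       (EFin \o (fun x => - complex.Im (alpha * f x) * weight r x)).
Proof.
move=> L2f r0; have [[mRe mIm] _] := L2f.
have iRe := integrable_mul_weight f r (fun x => complex.Re (f x)) L2f r0 mRe.
have iIm := integrable_mul_weight f r (fun x => complex.Im (f x)) L2f r0 mIm.
have {}iRe := iRe (fun x => ltac:(by rewrite lerDl sqr_ge0)).
have {}iIm := iIm (fun x => ltac:(by rewrite lerDr sqr_ge0)).
case: alpha => a b.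
have E : (fun x => - complex.Im ((a +i* b) * f x) * weight r x) =
   (fun x => - a * (complex.Im (f x) * weight r x)
             + - b * (complex.Re (f x) * weight r x)).
  by apply/funext => x; case: (f x) => u v /=; ring.
have ia : (leb R n).-integrable setT
    (EFin \o (fun x => - a * (complex.Im (f x) * weight r x))).
  exact: (integrableZl measurableT (- a) iIm).
have ib : (leb R n).-integrable setT
    (EFin \o (fun x => - b * (complex.Re (f x) * weight r x))).
  exact: (integrableZl measurableT (- b) iRe).
split; last by rewrite E; exact: (integrableD measurableT ia ib).
rewrite E RintegralD// !RintegralZl// /Mfun /integralC.
rewrite (_ : (fun x => complex.Re _) =
    (fun x => mu * (complex.Re (f x) * weight r x))); last first.
  by apply/funext => x; case: (f x) => u v; rewrite /weight /=; ring.
rewrite (_ : (fun x => complex.Im _) =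
    (fun x => mu * (complex.Im (f x) * weight r x))); last first.
  by apply/funext => x; case: (f x) => u v; rewrite /weight /=; ring.
by rewrite !RintegralZl//=; ring.
Qed.

Lemma enorm_box t x : (0 < n)%N -> 0 < t -> box t (2 * t) x ->
  t <= enorm x <= 2 * n%:R * t.
Proof.
move=> n0 t0 bx; have {}bx i : t <= x 0 i <= 2 * t by have := bx i; rewrite in_itv.
apply/andP; split.
  have /andP[ti _] := bx (Ordinal n0).
  rewrite -(gtr0_norm t0) -sqrtr_sqr ler_wsqrtr//.
  apply: le_trans (sqr_coord_le_dot x (Ordinal n0)).
  by rewrite lerXn2r ?nnegrE ?(le_trans (ltW t0) ti)// ltW.
have T0 : 0 <= 2 * n%:R * t by rewrite mulr_ge0// ltW.
rewrite -(ger0_norm T0) -sqrtr_sqr ler_wsqrtr//.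
apply: (@le_trans _ _ (\sum_(i < n) (2 * t) ^+ 2)).
  apply: ler_sum => i _; have /andP[ti it] := bx i; rewrite -expr2.
  by rewrite lerXn2r ?nnegrE ?(le_trans (ltW t0) ti)// mulr_ge0// ltW.
rewrite sumr_const card_ord -mulr_natr.
have n1 : 1 <= n%:R :> R by rewrite ler1n.
rewrite !exprMn.
have : 0 <= t ^+ 2 by rewrite sqr_ge0.
nra.
Qed.

(** One bound for both signs of [k]: for [k >= 0] the power [s^-k] is least at
    [s = a t], for [k < 0] at [s = t], where it equals [a^k (a t)^-k]. *)
Lemma powR_lower k (a s t : R) : 0 < t -> 0 < a -> t <= s <= a * t ->
  Num.min 1 (a `^ k) * (a * t) `^ (- k) <= s `^ (- k).
Proof.
move=> t0 a0 /andP[ts sat].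
have s0 : 0 < s by exact: lt_le_trans ts.
have at0 : 0 < a * t by rewrite mulr_gt0.
have [k0|k0] := leP 0 k.
  apply: (@le_trans _ _ ((a * t) `^ (- k))).
    by rewrite ler_piMl ?powR_ge0// ge_min lexx.
  by rewrite !powRN lef_pV2 ?posrE ?powR_gt0// ge0_ler_powR// nnegrE ltW.
apply: (@le_trans _ _ (t `^ (- k))).
  have -> : t `^ (- k) = a `^ k * (a * t) `^ (- k).
    rewrite powRM ?(ltW a0) ?(ltW t0)// mulrA -powRD ?subrr ?powRr0 ?mul1r//.
    by rewrite (gt_eqF a0) implybT.
  by rewrite ler_pM2r ?powR_gt0// ge_min lexx orbT.
by rewrite ge0_ler_powR ?nnegrE ?oppr_ge0// ltW.
Qed.

(** The integrand is at least a constant times [r^-k] on the box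
    [t <= x_i <= 2 t] with [t = r / (2 n)], which has volume [t^n] and lies in
    the shell [t <= |x| <= r].  Staying away from the origin is what makes the
    bound valid for negative [k]. *)
Lemma Mfun_lower alpha k f : (0 < n)%N -> L2 f ->
  {ae leb R n, forall x,
     (if enorm x <= 1 then enorm x `^ (- k) else 0) <= - complex.Im (alpha * f x)} ->
  exists2 c, 0 < c & forall mu r, 0 < mu -> 0 < r <= 1 ->
    mu * c * r `^ (n%:R - k) <= Mfun alpha (fun x => mu%:C * f x) r.
Proof.
move=> n0 L2f gf.
have N0 : 0 < 2 * n%:R :> R by rewrite mulr_gt0// ltr0n.
pose c1 : R := Num.min 1 ((2 * n%:R) `^ k).
have c10 : 0 < c1 by rewrite lt_min ltr01 powR_gt0.
pose s : R := (Num.sqrt 2) ^- n.+1.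
have s0 : 0 < s by rewrite invr_gt0 exprn_gt0// sqrtr_gt0.
exists (c1 * s * (2 * n%:R) ^- n).
  by rewrite !mulr_gt0// invr_gt0 exprn_gt0.
move=> mu r mu0 /andP[r0 r1]; have [-> ig] := MfunE alpha f mu r L2f r0.
rewrite -mulrA ler_pM2l//.
pose t := r / (2 * n%:R); have t0 : 0 < t by rewrite divr_gt0.
have rE : r = 2 * n%:R * t by rewrite /t mulrC divfK ?gt_eqF.
pose v := c1 * r `^ (- k) * s.
have v0 : 0 <= v by rewrite !mulr_ge0// ?powR_ge0// ltW.
have mB : measurable (box t (2 * t) : set 'rV[R]_n) by exact: measurable_box.
have tt : t <= 2 * t by lra.
have intB : (\int[leb R n]_x (v * \1_(box t (2 * t)) x)%:E = (v * t ^+ n)%:E)%E.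
  under eq_integral do rewrite EFinM.
  rewrite ge0_integralZl//; last by apply/measurable_EFinP; exact: measurable_indic.
  rewrite integral_indic// setIT leb_boxE// -EFinM.
  by congr (_ * _ ^+ _)%:E; ring.
have iB : (leb R n).-integrable setT (EFin \o (fun x => v * \1_(box t (2 * t)) x)).
  apply/integrableP; split.
    apply/measurable_EFinP; apply: measurable_funM => //; exact: measurable_indic.
  rewrite (eq_integral (fun x => (v * \1_(box t (2 * t)) x)%:E)) ?intB ?ltry//.
  by move=> x _; rewrite /= ger0_norm// mulr_ge0.
apply: (@le_trans _ _ (\int[leb R n]_x (v * \1_(box t (2 * t)) x))).
  rewrite /Rintegral intB /= /v /t powRD; last by rewrite (gt_eqF r0) implybT.
  rewrite powR_mulrn ?(ltW r0)// expr_div_n le_eqVlt; apply/orP; left; apply/eqP.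
  by ring.
apply: ae_le_Rintegral => //; apply: filterS gf => x gx.
have w0 := weight_gt0 r x.
have g0 : 0 <= - complex.Im (alpha * f x).
  by apply: le_trans gx; case: ifP => // _; exact: powR_ge0.
rewrite indicE; have [xB|xB] := boolP (x \in _); last first.
  by rewrite mulr0 mulr_ge0// ltW.
rewrite mulr1 /v; move: xB; rewrite inE => /(enorm_box t x n0 t0) /andP[tx xr].
apply: ler_pM; rewrite ?mulr_ge0 ?powR_ge0 ?(ltW c10) ?(ltW s0)//; last first.
  by apply: weight_ge_ball => //; rewrite rE.
apply: le_trans gx; rewrite -rE in xr; rewrite (le_trans xr r1) rE.
by apply: powR_lower; rewrite // -rE tx xr.
Qed.

End data.

(** * Choice of the radius *)

Section scaling.
Context {R : realType}.

(** The exponent [N - 1/(p-1)] of the threshold is the one for which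
    [r^(N(p-1)) (r^(N - 1/(p-1)))^(-(p-1))] is exactly [r]. *)
Lemma powR_lifespan (N p b r X : R) : 1 < p -> 0 < r -> 0 < b ->
  b * r `^ (N - 1 / (p - 1)) <= X ->
  r `^ (N * (p - 1)) * X `^ (- p + 1) <= b `^ (- p + 1) * r.
Proof.
move=> p1 r0 b0 bX; have p10 : 0 < p - 1 by rewrite subr_gt0.
have P0 : 0 < b * r `^ (N - 1 / (p - 1)) by rewrite mulr_gt0// powR_gt0.
have {}bX : X `^ (- p + 1) <= (b * r `^ (N - 1 / (p - 1))) `^ (- p + 1).
  rewrite (_ : - p + 1 = - (p - 1)); last by ring.
  have X0 := lt_le_trans P0 bX.
  by rewrite !powRN lef_pV2 ?posrE ?powR_gt0// ge0_ler_powR// ?nnegrE ltW.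
apply: le_trans (ler_wpM2l (powR_ge0 _ _) bX) _.
rewrite powRM ?powR_ge0 ?(ltW b0)// mulrCA ler_pM2l ?powR_gt0//.
rewrite -powRrM -powRD; last by rewrite (gt_eqF r0) implybT.
rewrite (_ : _ + _ = 1) ?powRr1 ?(ltW r0)//.
by field; rewrite gt_eqF.
Qed.

Lemma ler_jap (r m : R) : 0 <= r <= 1 -> jap (r * m) <= jap m.
Proof.
move=> /andP[r0 r1]; rewrite ler_wsqrtr// lerD2l exprMn ler_piMl ?sqr_ge0//.
by rewrite exprn_ile1.
Qed.

End scaling.

Theorem corollary1p11 (R : realType) (n : nat) (A : R) (K : 'rV[R]_n -> R[i])
  (p m k : R) (lambda alpha : R[i]) (f : 'rV[R]_n -> R[i]) :
  (1 <= n)%N ->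
  is_half_laplacian_bound n A ->
  is_bessel_kernel K ->
  1 < p ->
  lambda != 0 ->
  0 < complex.Re (alpha * lambda) ->
  k < Num.min (n%:R / 2) (1 / (p - 1)) ->
  L2 f ->
  {ae leb R n, forall x,
     (if enorm x <= 1 then enorm x `^ (- k) else 0) <= - complex.Im (alpha * f x)} ->
  exists mu0 C : R, 0 < mu0 /\ 0 < C /\
    forall mu : R, mu0 < mu ->
      let u0 := fun x => mu%:C * f x in
      exists R1 : R, 0 < R1 /\
        Mfun alpha u0 R1 >
          Ctilde p lambda alpha A K * jap (R1 * m) `^ (n.+2%:R / (p - 1))
          * R1 `^ (n%:R - 1 / (p - 1)) /\
        Ttilde p m lambda alpha A K u0 R1 <= C * mu `^ (- (1 / (1 / (p - 1) - k))).
Proof.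
move=> n0 _ _ p1 _ alam; rewrite lt_min => /andP[_ kp] L2f gf.
have [c c0 Mlow] := Mfun_lower alpha k f n0 L2f gf.
have p10 : 0 < p - 1 by rewrite subr_gt0.
set q := 1 / (p - 1) - k; have q0 : 0 < q by rewrite subr_gt0.
set e := n.+2%:R / (p - 1); have e0 : 0 <= e by rewrite divr_ge0// ltW.
set Ct := Ctilde p lambda alpha A K; have Ct0 : 0 <= Ct by exact: powR_ge0.
pose B := Ct * jap m `^ e; have B0 : 0 <= B by rewrite mulr_ge0// powR_ge0.
pose b := B + 1; have b0 : 0 < b by rewrite ltr_wpDl.
set D := Dconst n p lambda alpha.
have D0 : 0 <= D by rewrite !mulr_ge0 ?powR_ge0// ltW.
pose mu0 := 2 * b / c; have mu00 : 0 < mu0 by rewrite divr_gt0// mulr_gt0.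
pose X := (p - 1)^-1 * D^-1 * (b `^ (- p + 1) * mu0 `^ (1 / q)).
have X0 : 0 <= X by rewrite !mulr_ge0 ?powR_ge0 ?invr_ge0// ltW.
(* [X >= 0] is immediate from the shape of [D]; adding [1] makes the constant
   positive without an argument that the integral of [<x>^(-n-1)] is positive. *)
exists mu0, (X + 1); split=> //; split; first by rewrite ltr_wpDl.
move=> mu mu0mu u0; have mugt0 : 0 < mu := lt_trans mu00 mu0mu.
pose r := (mu0 / mu) `^ (1 / q).
have r0 : 0 < r by rewrite powR_gt0// divr_gt0.
have r1 : r <= 1.
  have q1 : 0 <= 1 / q by rewrite divr_ge0// ltW.
  have s1 : mu0 / mu <= 1 by rewrite ler_pdivrMr// mul1r ltW.
  have := ge0_ler_powR q1 _ _ s1; rewrite powR1 !nnegrE => -> //.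
  by rewrite divr_ge0// ltW.
have rq : r `^ q = mu0 / mu.
  by rewrite -powRrM div1r mulVf ?gt_eqF// powRr1// divr_ge0// ltW.
set P := r `^ (n%:R - 1 / (p - 1)); have P0 : 0 < P by rewrite powR_gt0.
have ME : 2 * b * P <= Mfun alpha u0 r.
  apply: le_trans (Mlow mu r mugt0 _); last by rewrite r0.
  rewrite (_ : n%:R - k = q + (n%:R - 1 / (p - 1))); last by rewrite /q; ring.
  rewrite powRD ?(gt_eqF r0) ?implybT// rq -/P mulrA ler_pM2r// /mu0.
  by rewrite le_eqVlt; apply/orP; left; apply/eqP; field; rewrite !gt_eqF.
have CB : Ct * jap (r * m) `^ e <= B.
  rewrite ler_wpM2l// ge0_ler_powR ?nnegrE ?sqrtr_ge0// ler_jap//.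
  by rewrite r1 ltW.
have CP : Ct * jap (r * m) `^ e * P <= B * P by rewrite ler_pM2r.
exists r; split=> //; split.
  apply: le_lt_trans CP _; apply: lt_le_trans ME.
  by rewrite ltr_pM2r// /b; lra.
have rE : r = mu0 `^ (1 / q) * mu `^ (- (1 / q)).
  rewrite /r powRM ?invr_ge0 ?(ltW mu00) ?(ltW mugt0)//.
  by rewrite -(powR_inv1 (ltW mugt0)) -powRrM mulN1r.
have bP : b * P <= Mfun alpha u0 r - jap (r * m) `^ e * Ct * P.
  rewrite [jap _ `^ _ * _]mulrC; have : b * P = B * P + P by rewrite /b; ring.
  have : 2 * b * P = b * P + b * P by ring.
  lra.
have := powR_lifespan n%:R p b r _ p1 r0 b0 bP.
have pD0 : 0 <= (p - 1)^-1 / D by rewrite mulr_ge0 ?invr_ge0// ltW.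
move=> /(ler_wpM2l pD0); rewrite mulrA => /le_trans; apply.
rewrite [leLHS](_ : _ = X * mu `^ (- (1 / q))); last by rewrite {1}rE /X; ring.
by rewrite ler_wpM2r ?powR_ge0// lerDl.
Qed.
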